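(* The set $\beta(D_h)\subset\mathsf{T}^*(N\times P)$ is generated by the Morse family $$-H_h:N\times P\times V^+\to\mathbb{R},\qquad H_h(x,\mathbf{p},v)=\langle\mathbf{p},v\rangle-\ell_h(x,v),$$ fibred over $N\times P$ by $(x,\mathbf{p},v)\mapsto(x,\mathbf{p})$.
   Context: Newtonian space-time: $N$ is a four-dimensional real affine space with model vector space $V$, $\tau\in V^*$ is non-zero, $E_0=\ker\tau$, and $g:E_0\to E_0^*$ is a Euclidean metric (symmetric, positive definite). $E_1=\{v\in V:\langle\tau,v\rangle=1\}$ (inertial frames), $V^+=\{v\in V:\langle\tau,v\rangle>0\}$. For $u\in E_1$, $\imath_u:V\to E_0$, $\imath_u(v)=v-\langle\tau,v\rangle u$, and $\imath_u^*:E_0^*\to V^*$ is its dual. $m>0$ is the mass and $\varphi:N\to\mathbb{R}$ is a smooth potential. The homogeneous Lagrangian in frame $u$ is $$\ell_{h,u}(x,v)=\frac{m}{2\langle\tau,v\rangle}\langle g(\imath_u(v)),\imath_u(v)\rangle-\langle\tau,v\rangle\varphi(x),\quad (x,v)\in N\times V^+.$$ For $u,u'\in E_1$ put $\sigma(u',u)=\imath^*_{(u+u')/2}(g(u'-u))\in V^*$. The space $W$: the quotient of $E_1\times V\times\mathbb{R}$ by the equivalence relation $(u,v,r)\sim(u',v',r')$ iff $v=v'$ and $r=r'+m\langle\sigma(u',u),v\rangle$; classes are written $[u,v,r]$. The projection $W\to V$ is $[u,v,r]\mapsto v$, and two elements of the same fibre have a real difference: $[u,v,r]-[u,v,r']=r-r'$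 (independent of $u$). The affine Lagrangian is $\ell_h(x,v)=[u,v,\ell_{h,u}(x,v)]\in W$ for $(x,v)\in N\times V^+$; it does not depend on $u\in E_1$. The space $P$: the quotient of $E_1\times V^*$ by $(u,p)\sim(u',p')$ iff $p=p'+m\sigma(u',u)$; classes are written $[u,p]$. $P$ is an affine space modelled on $V^*$ by $[u,p]+\pi=[u,p+\pi]$. The pairing of $\mathbf{p}=[u,p]\in P$ and $v\in V$ is $\langle\mathbf{p},v\rangle=[u,v,\langle p,v\rangle]\in W$ (independent of the representative). Thus $\langle\mathbf{p},v\rangle-\ell_h(x,v)$ is the difference of two elements of the fibre of $W$ over $v$, a real number. Identify $\mathsf{T}(N\times P)\simeq N\times P\times V\times V^*$ and $\mathsf{T}^*(N\times P)\simeq N\times P\times V^*\times V$. The map $\beta:\mathsf{T}(N\times P)\to\mathsf{T}^*(N\times P)$ is $\beta(x,\mathbf{p},v,a)=(x,\mathbf{p},a,-v)$. Dynamics: $D_{h,u}\subset\mathsf{T}\mathsf{T}^*N\simeq N\times V^*\times V\times V^*$ is the set of $(x,p,\dot x,\dot p)$ such that for some $v\in V^+$: $\dot x=v$, $\dot p=-\langle\tau,v\rangle\,\mathrm{d}\varphi(x)$ and $p=\frac{m}{\langle\tau,v\rangle}\imath_u^*(g(\imath_u(v)))-\frac{m}{2\langle\tau,v\rangle^2}\langle g(\imath_u(v)),\imath_u(v)\rangle\tau-\varphi(x)\tau$. The frame-independent dynamics is $D_h=\{(x,[u,p],\dot x,\dot p):(x,p,\dot x,\dot p)\in D_{h,u}\}\subset\mathsf{T}(N\times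 P)$, which does not depend on $u\in E_1$. Generating families: given a surjective submersion $\zeta:X\to B$ and a smooth function $F:X\to\mathbb{R}$, the subset of $\mathsf{T}^*B$ generated by $F$ is the set of covectors $b\in\mathsf{T}^*_{q}B$, $q\in B$, for which there is $y\in\zeta^{-1}(q)$ with $\mathrm{d}F(y)=b\circ\mathsf{T}_y\zeta$. $F$ is a Morse family if, in local coordinates $(q,\lambda)$ on $X$ adapted to $\zeta$, the matrix $(\partial^2F/\partial\lambda\partial q,\ \partial^2F/\partial\lambda\partial\lambda)$ has maximal rank at all points where $\partial F/\partial\lambda=0$. *)

(* Defs.v *)
From HB Require Import structures.
From mathcomp Require Import all_boot all_order all_algebra generic_quotient.
From mathcomp Require Import boolp classical_sets reals topology normedtype derive.
From mathcomp Require Import ring.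
Import passmx.

Set Implicit Arguments.
Unset Strict Implicit.
Unset Printing Implicit Defensive.
Import Order.TTheory GRing.Theory Num.Theory numFieldNormedType.Exports.
Local Open Scope ring_scope.
Local Open Scope classical_set_scope.
Local Open Scope quotient_scope.

Notation dual E := 'Hom(E, (_ : fieldType)^o).

(** * Affine spaces and calculus on them *)

Record affineSpace (K : fieldType) (E : vectType K) := AffineSpace {
  affine_carrier :> Type;
  translate : affine_carrier -> E -> affine_carrier;
  affine_inhabited : inhabited affine_carrier;
  translate0 : forall x, translate x 0 = x;
  translateD : forall x v w, translate (translate x v) w = translate x (v + w);
  translate_exU : forall x y, exists! v, translate x v = y }.

Section AffineConstructions.
Context (K : fieldType) (E1 E2 : vectType K).

Lemma affine_self_exU (x y : E1) : exists! v, x + v = y.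
Proof.
exists (y - x); split; first by rewrite addrC subrK.
by move=> v <-; rewrite addrC addKr.
Qed.

Definition affine_self : affineSpace E1 :=
  @AffineSpace K E1 E1 (fun x v => x + v) (inhabits 0) (@addr0 E1)
    (fun x v w => esym (addrA x v w)) affine_self_exU.

Context (A1 : affineSpace E1) (A2 : affineSpace E2).

Definition prod_translate (x : A1 * A2) (v : E1 * E2) : A1 * A2 :=
  (translate x.1 v.1, translate x.2 v.2).

Lemma prod_inhabited : inhabited (A1 * A2).
Proof.
by have [x] := affine_inhabited A1; have [y] := affine_inhabited A2; exists.
Qed.

Lemma prod_translate0 x : prod_translate x 0 = x.
Proof. by case: x => x y; rewrite /prod_translate /= !translate0. Qed.

Lemma prod_translateD x v w :
  prod_translate (prod_translate x v) w = prod_translate x (v + w).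
Proof. by rewrite /prod_translate /= !translateD. Qed.

Lemma prod_translate_exU x y : exists! v, prod_translate x v = y.
Proof.
case: x y => [x1 x2] [y1 y2].
have [v1 [<- u1]] := translate_exU x1 y1.
have [v2 [<- u2]] := translate_exU x2 y2.
exists (v1, v2); split=> // -[w1 w2]; rewrite /prod_translate /= => -[e1 e2].
by rewrite (u1 _ e1) (u2 _ e2).
Qed.

Definition affine_prod : affineSpace (E1 * E2)%type :=
  AffineSpace prod_inhabited prod_translate0 prod_translateD prod_translate_exU.

End AffineConstructions.

Section AffineCalculus.
Context (R : realType) (E : vectType R) (A : affineSpace E).
Implicit Types (F : A -> R) (U : set A) (x : A) (w : E) (k : nat).

(* A [vectType] carries no topology: the topology and the differential
   structure of [A] are read off in affine coordinates centred at a point. *)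
Definition affine_chart x (z : 'rV[R]_(\dim {:E})) : A :=
  translate x (vecof (vbasis {:E}) z).

Definition in_chart F x (z : 'rV[R]_(\dim {:E})) : R := F (affine_chart x z).

Definition affine_open U :=
  forall x, U x -> \forall z \near (0 : 'rV[R]_(\dim {:E})), U (affine_chart x z).

Definition affine_diff F x : dual E :=
  linfun (fun w => 'd (in_chart F x) 0 (rVof (vbasis {:E}) w) : R^o).

Definition partial F w x : R := 'D_(rVof (vbasis {:E}) w) (in_chart F x) 0.

Fixpoint Ck_on k U F : Prop :=
  match k with
  | 0 => forall x, U x -> {for 0, continuous (in_chart F x)}
  | k'.+1 => (forall x, U x -> differentiable (in_chart F x) 0) /\
             (forall w, Ck_on k' U (partial F w))
  end.

Definition smooth_on U F := forall k, Ck_on k U F.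

(* T A and T^* A, trivialised by the affine structure. *)
Definition tangent : Type := A * E.
Definition cotangent : Type := A * dual E.

End AffineCalculus.

(** * Generating families over an affine base
    The total space is an open part [X] of [B * L], fibred by the projection
    [fst]; [F] is a total function of which only the values on [X] matter. *)

Section GeneratingFamilies.
Context (R : realType) (G L : vectType R) (B : affineSpace G).
Let Y := affine_prod B (affine_self L).
Implicit Types (X : set Y) (F : Y -> R).

(* The composite with [linfun fst] is the composite with the tangent map of
   the fibration. *)
Definition generated X F : set (cotangent B) :=
  [set b | exists l : L, X (b.1, l) /\
     affine_diff F (b.1, l) = (b.2 \o linfun (fst : G * L -> G))%VF].

Section Coordinates.
Context (n k : nat) (e : n.-tuple G) (f : k.-tuple L) (F : Y -> R) (y : Y).
(* If [e] and [f] are bases, these are the coordinate fields of adapted affine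
   coordinates [(q, lambda)] on [B * L]. *)
Let d_q (j : 'I_n) (H : Y -> R) := partial H (tnth e j, 0).
Let d_l (i : 'I_k) (H : Y -> R) := partial H (0, tnth f i).

Definition fibre_critical := forall i, d_l i F y = 0.

Definition morse_matrix : 'M[R]_(k, n + k) :=
  row_mx (\matrix_(i, j) d_l i (d_q j F) y) (\matrix_(i, j) d_l i (d_l j F) y).
End Coordinates.

(* [row_free]: the k x (n + k) matrix has its maximal rank k. *)
Definition morse_family X F :=
  [/\ affine_open X, (forall q : B, exists l : L, X (q, l)), smooth_on X F &
    forall (n k : nat) (e : n.-tuple G) (f : k.-tuple L),
      basis_of {:G} e -> basis_of {:L} f ->
      forall y, X y -> fibre_critical f F y -> row_free (morse_matrix e f F y)].

End GeneratingFamilies.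

(** * Newtonian space-time *)

Record newtonianSpacetime (R : realType) := NewtonianSpacetime {
  st_V : vectType R;
  st_dim : \dim {:st_V} = 4%N;
  st_N : affineSpace st_V;
  st_tau : dual st_V;
  st_tau_neq0 : st_tau != 0;
  st_g : 'Hom(subvs_of (lker st_tau), dual (subvs_of (lker st_tau)));
  st_g_sym : forall a b, st_g a b = st_g b a;
  st_g_pos : forall a, a != 0 -> 0 < st_g a a :> R }.

Section Newtonian.
Context (R : realType) (S : newtonianSpacetime R) (m : R).

Local Notation V := (st_V S).
Local Notation N := (st_N S).
Local Notation tau := (@st_tau R S).
Local Notation E0 := (subvs_of (lker tau)).
Local Notation g := (@st_g R S).

Definition frame := {u : V | tau u == 1}.

Definition Vplus : set V := [set v | 0 < (tau v : R)].

(* [vsproj] is a linear projection of [V] onto [E0]; when [tau u = 1] it is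
   applied to an element of [E0], see [iota_val]. *)
Definition iota_fun (u v : V) : E0 := vsproj (lker tau) (v - (tau v : R) *: u).

Lemma iota_funE u v :
  iota_fun u v = vsproj (lker tau) v - (tau v : R) *: vsproj (lker tau) u.
Proof. by rewrite /iota_fun linearB linearZ. Qed.

Lemma iota_linear u : linear (iota_fun u).
Proof.
move=> a v w; rewrite !iota_funE !linearP /= scalerBr !scalerDl.
by rewrite opprD addrACA -!scalerA.
Qed.

HB.instance Definition _ u :=
  GRing.isLinear.Build R V E0 _ (iota_fun u) (iota_linear u).

Definition iota (u : V) : 'Hom(V, E0) := linfun (iota_fun u).

Definition iota_dual (u : V) (f : dual E0) : dual V := (f \o iota u)%VF.

Lemma iota_val (u : frame) v : vsval (iota (val u) v) = v - (tau v : R) *: val u.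
Proof.
rewrite lfunE /= vsprojK // memv_ker linearB linearZ /= (eqP (valP u)).
by rewrite /GRing.scale /= mulr1 subrr.
Qed.

Definition sigma (u' u : frame) : dual V :=
  iota_dual (2^-1 *: (val u + val u')) (g (vsproj (lker tau) (val u' - val u))).

Lemma diff_frames_val (u u' : frame) :
  vsval (vsproj (lker tau) (val u' - val u)) = val u' - val u.
Proof.
by rewrite vsprojK // memv_ker linearB /= (eqP (valP u)) (eqP (valP u')) subrr.
Qed.

Let pr (v : V) : E0 := vsproj (lker tau) v.
Let c (u v : V) : R := g (pr u) (pr v) - tau v / 2 * g (pr u) (pr u).

Let gBl a b d : g (a - b) d = g a d - g b d :> R.
Proof. by rewrite linearB /= !lfunE /= !lfunE. Qed.
Let gBr a b d : g d (a - b) = g d a - g d b :> R.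
Proof. by rewrite linearB. Qed.
Let gDr a b d : g d (a + b) = g d a + g d b :> R.
Proof. by rewrite linearD. Qed.
Let gZl (s : R) a d : g (s *: a) d = s * g a d :> R.
Proof. by rewrite linearZ /= lfunE. Qed.
Let gZr (s : R) a d : g d (s *: a) = s * g d a :> R.
Proof. by rewrite linearZ. Qed.

Lemma sigma_cobound u' u v : sigma u' u v = c (val u') v - c (val u) v :> R.
Proof.
rewrite /sigma /iota_dual lfunE /= lfunE /= iota_funE.
rewrite -/(pr _) -/(pr _) -/(pr _).
have -> : pr (2^-1 *: (val u + val u')) = 2^-1 *: (pr (val u) + pr (val u')).
  by rewrite /pr linearZ linearD.
have -> : pr (val u' - val u) = pr (val u') - pr (val u) by rewrite /pr linearB.
rewrite gBl !gBr !gZr !gDr (st_g_sym (pr (val u')) (pr (val u))) /c.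
by field.
Qed.

Definition W_rel : rel (frame * V * R) := fun a b =>
  (a.1.2 == b.1.2) && (a.2 == b.2 + m * sigma b.1.1 a.1.1 a.1.2).

Lemma W_rel_refl : reflexive W_rel.
Proof. by move=> a; rewrite /W_rel !eqxx sigma_cobound subrr mulr0 addr0 /=. Qed.

Lemma W_rel_sym : symmetric W_rel.
Proof.
move=> [[u v] r] [[u' v'] r']; rewrite /W_rel /= eq_sym.
case: eqP => //= ->; rewrite !sigma_cobound; apply/eqP/eqP => ->; ring.
Qed.

Lemma W_rel_trans : transitive W_rel.
Proof.
move=> [[u' v'] r'] [[u v] r] [[u'' v''] r'']; rewrite /W_rel /=.
move=> /andP[/eqP-> /eqP->] /andP[/eqP-> /eqP->]; rewrite eqxx /=.
by rewrite !sigma_cobound; apply/eqP; ring.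
Qed.

Canonical W_equiv := EquivRel W_rel W_rel_refl W_rel_sym W_rel_trans.
Definition W := {eq_quot W_equiv}.
Definition W_class (u : frame) (v : V) (r : R) : W := \pi_W (u, v, r).

Lemma W_classP u v r u' v' r' :
  W_class u v r = W_class u' v' r' <-> v = v' /\ r = r' + m * sigma u' u v.
Proof.
split=> [/eqmodP/andP[/eqP + /eqP]|[e1 e2]]; first by [].
by apply/eqmodP/andP; split; apply/eqP.
Qed.

Definition W_proj (w : W) : V := (repr w).1.2.

Lemma W_projE u v r : W_proj (W_class u v r) = v.
Proof.
rewrite /W_proj; have := reprK (W_class u v r).
by case: (repr _) => -[u' v'] r' /W_classP [].
Qed.

(* Meaningful for [w] and [w'] in the same fibre: the representative of [w'] is
   moved to the frame of the representative of [w]. *)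
Definition W_diff (w w' : W) : R :=
  let: (u, v, r) := repr w in let: (u', _, r') := repr w' in
  r - (r' + m * sigma u' u v).

Lemma W_diffE u v r r' : W_diff (W_class u v r) (W_class u v r') = r - r'.
Proof.
rewrite /W_diff; have := reprK (W_class u v r).
case: (repr _) => -[u1 v1] r1 /W_classP [-> ->].
have := reprK (W_class u v r'); case: (repr _) => -[u2 v2] r2 /W_classP [-> ->].
rewrite !sigma_cobound; ring.
Qed.

Definition P_rel : rel (frame * dual V) := fun a b =>
  a.2 == b.2 + m *: sigma b.1 a.1.

Let sigma_refl u : sigma u u = 0.
Proof. by apply/lfunP => v; rewrite sigma_cobound subrr lfunE. Qed.

Let sigma_sym u u' : sigma u u' = - sigma u' u.
Proof.
apply/lfunP => v; rewrite opp_lfunE !sigma_cobound.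
exact: esym (opprB _ _).
Qed.

Let sigma_trans u u' u'' : sigma u'' u' + sigma u' u = sigma u'' u.
Proof.
apply/lfunP => v; rewrite add_lfunE !sigma_cobound; ring.
Qed.

Lemma P_rel_refl : reflexive P_rel.
Proof. by move=> a; rewrite /P_rel sigma_refl scaler0 addr0. Qed.

Lemma P_rel_sym : symmetric P_rel.
Proof.
move=> [u p] [u' p']; rewrite /P_rel /= (sigma_sym u u') scalerN.
by rewrite -subr_eq eq_sym.
Qed.

Lemma P_rel_trans : transitive P_rel.
Proof.
move=> [u' p'] [u p] [u'' p'']; rewrite /P_rel /= => /eqP-> /eqP->.
by rewrite -addrA -scalerDr sigma_trans.
Qed.

Canonical P_equiv := EquivRel P_rel P_rel_refl P_rel_sym P_rel_trans.
Definition P := {eq_quot P_equiv}.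
Definition P_class (u : frame) (p : dual V) : P := \pi_P (u, p).

Lemma P_classP u p u' p' :
  P_class u p = P_class u' p' <-> p = p' + m *: sigma u' u.
Proof.
by split=> [/eqmodP/eqP //|e]; apply/eqmodP/eqP.
Qed.

Definition P_translate (q : P) (pi : dual V) : P :=
  P_class (repr q).1 ((repr q).2 + pi).

Lemma P_translateE u p pi :
  P_translate (P_class u p) pi = P_class u (p + pi).
Proof.
rewrite /P_translate; have := reprK (P_class u p).
case: (repr _) => u' p' /P_classP -> /=; apply/P_classP.
by rewrite addrAC.
Qed.

Lemma P_classE u (q : P) : exists p, q = P_class u p.
Proof.
rewrite -[q]reprK; case: (repr q) => u' p'.
by exists (p' + m *: sigma u' u); apply/esym/P_classP.
Qed.

(* A non-zero form takes the value 1. *)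
Lemma frame_exists : exists u : V, tau u == 1.
Proof.
have [v tv] : exists v, tau v != 0.
  apply: contrapT => h; move/eqP: (st_tau_neq0 S); apply.
  apply/lfunP => v; rewrite zero_lfunE; apply: contrapT => /eqP tv.
  by apply: h; exists v.
by exists ((tau v : R)^-1 *: v); rewrite linearZ /=; apply/eqP/mulVf.
Qed.

Definition frame0 : frame := exist _ (xchoose frame_exists) (xchooseP frame_exists).

Lemma P_inhabited : inhabited P.
Proof. exact: inhabits (P_class frame0 0). Qed.

Lemma P_translate0 q : P_translate q 0 = q.
Proof. by have [p ->] := P_classE frame0 q; rewrite P_translateE addr0. Qed.

Lemma P_translateD q v w :
  P_translate (P_translate q v) w = P_translate q (v + w).
Proof. by have [p ->] := P_classE frame0 q; rewrite !P_translateE addrA. Qed.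

Lemma P_translate_exU q q' : exists! v, P_translate q v = q'.
Proof.
have [p ->] := P_classE frame0 q; have [p' ->] := P_classE frame0 q'.
have e v : P_translate (P_class frame0 p) v = P_class frame0 p' <-> v = p' - p.
  rewrite P_translateE P_classP sigma_refl scaler0 addr0; split=> [<-|->].
    by rewrite addrC addKr.
  by rewrite addrC subrK.
by exists (p' - p); split=> [|v /e ->]; first exact/e.
Qed.

Definition affine_P : affineSpace (dual V) :=
  AffineSpace P_inhabited P_translate0 P_translateD P_translate_exU.

Definition pairing (q : P) (v : V) : W := W_class (repr q).1 v ((repr q).2 v).

Lemma pairingE u p v : pairing (P_class u p) v = W_class u v (p v).
Proof.
rewrite /pairing; have := reprK (P_class u p).
case: (repr _) => u' p' /P_classP -> /=; apply/W_classP.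
by rewrite add_lfunE scale_lfunE.
Qed.

Context (phi : N -> R).

Definition lagrangian (u : frame) (x : N) (v : V) : R :=
  m / (2 * tau v) * g (iota (val u) v) (iota (val u) v) - tau v * phi x.

(* [lagrangian], [affine_lagrangian] and [hamiltonian] are only meaningful for
   [v] in [Vplus]; [frame0] plays no role there, see [affine_lagrangianE]. *)
Definition affine_lagrangian (x : N) (v : V) : W :=
  W_class frame0 v (lagrangian frame0 x v).

Lemma lagrangian_frame u u' x v : Vplus v ->
  lagrangian u x v = lagrangian u' x v + m * sigma u' u v.
Proof.
rewrite /Vplus /= => /lt0r_neq0 tv; rewrite /lagrangian sigma_cobound /c !lfunE /=.
rewrite !iota_funE -/(pr _) -/(pr _) -/(pr _) !gBl !gBr !gZl !gZr.
rewrite (st_g_sym (pr (val u)) (pr v)) (st_g_sym (pr (val u')) (pr v)).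
by field.
Qed.

Lemma affine_lagrangianE u x v : Vplus v ->
  affine_lagrangian x v = W_class u v (lagrangian u x v).
Proof.
by move=> vp; apply/W_classP; split=> //; exact: lagrangian_frame.
Qed.

Definition affine_NP : affineSpace (V * dual V)%type := affine_prod N affine_P.

Definition hamiltonian (y : N * P * V) : R :=
  let: (x, q, v) := y in W_diff (pairing q v) (affine_lagrangian x v).

Definition NPVplus : set (N * P * V) := [set y | Vplus y.2].

(* T^*(N x P) = N x P x V^* x V: the pair [(a, w)] is the covector
   (dx, dp) |-> <a, dx> + <dp, w>. *)
Definition NP_covector_fun (a : dual V) (w : V) (d : V * dual V) : R^o :=
  a d.1 + d.2 w.

Lemma NP_covector_linear a w : linear (NP_covector_fun a w).
Proof.
move=> s d d'; rewrite /NP_covector_fun /= linearP /= add_lfunE scale_lfunE /=.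
by rewrite scalerDr addrACA.
Qed.

HB.instance Definition _ a w :=
  GRing.isLinear.Build R (V * dual V)%type R^o _ (NP_covector_fun a w)
    (NP_covector_linear a w).

Definition NP_covector a w : dual (V * dual V)%type := linfun (NP_covector_fun a w).

Definition beta (z : tangent affine_NP) : cotangent affine_NP :=
  let: (q, (v, a)) := z in (q, NP_covector a (- v)).

(* Subset of T T^* N = (N x V^* ) x (V x V^* ). *)
Definition dynamics_in (u : frame) : set ((N * dual V) * (V * dual V)) :=
  [set z | let: ((x, p), (xdot, pdot)) := z in
    exists v, [/\ Vplus v, xdot = v,
      pdot = - (tau v : R) *: affine_diff phi x &
      p = (m / tau v) *: iota_dual (val u) (g (iota (val u) v))
          - (m / (2 * tau v ^+ 2) * g (iota (val u) v) (iota (val u) v)) *: tau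
          - phi x *: tau]].

Definition dynamics_of (u : frame) : set (tangent affine_NP) :=
  [set ((z.1.1, P_class u z.1.2), z.2) | z in dynamics_in u].

(* Independent of the frame, see [dynamicsE]. *)
Definition dynamics : set (tangent affine_NP) := dynamics_of frame0.

Let momentum_frame u u' v (s : R) : tau v != 0 :> R ->
  let p u := (m / tau v) *: iota_dual (val u) (g (iota (val u) v))
    - (m / (2 * tau v ^+ 2) * g (iota (val u) v) (iota (val u) v)) *: tau
    - s *: tau in
  p u = p u' + m *: sigma u' u.
Proof.
move=> tv /=; apply/lfunP => z.
rewrite !(add_lfunE, opp_lfunE, scale_lfunE) sigma_cobound /iota_dual !lfunE /=.
rewrite !lfunE /= !iota_funE -/(pr _) -/(pr _) -/(pr _) -/(pr _).
rewrite /c /GRing.scale /= !gBl !gBr !gZl !gZr.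
rewrite !(st_g_sym (pr (val u)) (pr v)) !(st_g_sym (pr (val u')) (pr v)).
by field.
Qed.

Lemma dynamicsE u : dynamics = dynamics_of u.
Proof.
suff sub u1 u2 : dynamics_of u1 `<=` dynamics_of u2 by apply/seteqP; split; apply: sub.
move=> _ [[[x p] [xd pd]] [v [vp -> -> pE]] <-] /=.
have tv : tau v != 0 :> R by exact: lt0r_neq0.
have /P_classP -> := etrans pE (momentum_frame u1 u2 (phi x) tv).
by eexists (x, _, (v, _)) => //=; exists v; split.
Qed.

End Newtonian.

Arguments Vplus {R} S.
Arguments NPVplus {R} S m.
Arguments affine_NP {R} S m.
Arguments hamiltonian {R S} m phi y.
Arguments beta {R} S m z.
Arguments dynamics {R S} m phi.
Arguments dynamics_of {R S} m phi u.
Arguments generated {R G L} B X F.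
Arguments morse_family {R G L} B X F.

(* Main.v *)
From HB Require Import structures.
Require Import Defs.
From mathcomp Require Import all_boot all_order all_algebra.
From mathcomp Require Import boolp classical_sets reals topology normedtype derive.
From mathcomp Require Import functions landau ring.
Import passmx.

Set Implicit Arguments.
Unset Strict Implicit.
Unset Printing Implicit Defensive.
Import Order.TTheory GRing.Theory Num.Theory numFieldNormedType.Exports.
Local Open Scope ring_scope.
Local Open Scope classical_set_scope.

(** In the frame [frame0] the function [- hamiltonian m phi] is
    L (x, v) - <p, v>.  Its fibre derivative vanishes exactly when [p] is the
    Legendre momentum of [v], and its base derivative is then
    (- <tau, v> dphi, - v), i.e. the [beta]-image of the dynamics.  It is a Morse
    family because the p-part of the mixed Hessian is minus the (perfect) pairing
    of V^* with V. *)

(** * Locality of continuity and differentiability; linear maps on row vectors *)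

Lemma near_eq_continuous_at (T U : topologicalType) (f g : T -> U) (a : T) :
  (\near a, f a = g a) -> {for a, continuous f} -> {for a, continuous g}.
Proof.
move=> fg; rewrite /prop_for /continuous_at (nbhs_singleton fg).
by apply: cvg_trans; apply: near_eq_cvg; apply: filterS fg => z ->.
Qed.

(** The first-order expansion of [f] at [a] is also one of [g], the remainders being equal near 0;
    uniqueness of the differential then identifies ['d g a] with ['d f a]. *)
Lemma near_eq_differentiable (R : numFieldType) (V W : normedModType R)
    (f g : V -> W) (a : V) :
  (\near a, f a = g a) -> differentiable f a -> differentiable g a.
Proof.
move=> fg /diff_locallyP[df_cont fE].
have gE : g \o shift a = cst (g a) + 'd f a +o_ 0 id.
  apply/eqaddoP => e e0; have /eqaddoP/(_ e e0) := fE.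
  have : \forall z \near 0, f (z + a) = g (z + a).
    by move: fg; rewrite (near_shift 0) /=; apply: filterS => z; rewrite subr0.
  apply: filterS2 => z fgz; move: fgz (nbhs_singleton fg).
  by rewrite !fctE /= => -> ->.
by apply/diff_locallyP; rewrite (diff_unique df_cont gE).
Qed.

(** In the standard basis the map is a finite sum of coordinate functions times fixed vectors. *)
Lemma rV_linear_continuous (R : realType) n (W : normedModType R)
  (f : {linear 'rV[R]_n -> W}) : continuous f.
Proof.
have -> : f = (fun z => \sum_i z 0 i *: f (delta_mx 0 i)) :> (_ -> _).
  apply/funext => z; rewrite {1}[z]row_sum_delta linear_sum.
  by apply: eq_bigr => i _; rewrite linearZ.
have add_cont : continuous (fun p : W * W => p.1 + p.2) by exact: add_continuous.
apply: (continuous_big add_cont) => i _ z.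
apply: (@continuous_comp _ _ _ (fun y : 'rV[R]_n => y 0 i)
  (fun c => c *: f (delta_mx 0 i))); first exact: coord_continuous.
exact: scalel_continuous.
Qed.

(** * Differential calculus and [Ck_on] functions on an affine space *)

Section AffineCalculusTheory.
Context (R : realType) (E : vectType R) (A : affineSpace E).
Implicit Types (F G : A -> R) (U : set A) (x : A) (w : E) (k : nat).

(** In the chart at [x] the function is a constant plus the linear form [l \o vecof], so its
    differential at 0 is that form. All smoothness proofs start from this case. *)
Lemma in_chart_affine F (l : dual E) x :
  (forall v, F (translate x v) = F x + l v) ->
  differentiable (in_chart F x) 0 /\ forall w, partial F w x = l w.
Proof.
move=> Fl; pose f : {linear 'rV[R]_(\dim {:E}) -> R^o} := l \o vecof (vbasis {:E}).
have fc := @rV_linear_continuous R _ _ f.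
have FE : in_chart F x = (cst (F x) : _ -> R) + (f : _ -> R).
  by apply/funext => z; rewrite /in_chart /affine_chart Fl.
have df : differentiable (f : _ -> R) 0 by apply: linear_differentiable.
rewrite /partial FE; split=> [|w]; first exact: differentiableD.
rewrite (deriveD (derivable_cst _ _ _) (diff_derivable df)).
rewrite derive_cst add0r deriveE // diff_lin //=.
by rewrite (rVofK (vbasisP _)).
Qed.

Lemma Ck_on_cst k U c : Ck_on k U (fun=> c).
Proof.
have dc x (d : R) := (@in_chart_affine (fun=> d) 0 x).
have {}dc x d : differentiable (in_chart (fun=> d) x) 0 /\ forall w, partial (fun=> d) w x = 0.
  have [|dF pF] := dc x d; first by move=> v; rewrite lfunE /= addr0.
  by split=> // w; rewrite pF lfunE.
elim: k c => [|k IH] c.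
  by move=> x _; apply: differentiable_continuous; exact: (dc x c).1.
split=> [x _|w]; first exact: (dc x c).1.
by have -> : partial (fun _ : A => c) w = fun=> 0 by apply/funext => x; rewrite (dc x c).2.
Qed.

Lemma Ck_on_affine k U F (l : dual E) :
  (forall x v, F (translate x v) = F x + l v) -> Ck_on k U F.
Proof.
move=> Fl; have dF x := in_chart_affine (Fl x).
case: k => [|k]; first by move=> x _; apply: differentiable_continuous; exact: (dF x).1.
split=> [x _|w]; first exact: (dF x).1.
have -> : partial F w = fun=> l w by apply/funext => x; rewrite (dF x).2.
exact: Ck_on_cst.
Qed.

Lemma affine_chart0 x : affine_chart x 0 = x.
Proof. by rewrite /affine_chart linear0 translate0. Qed.

Lemma in_chart0 F x : in_chart F x 0 = F x.
Proof. by rewrite /in_chart affine_chart0. Qed.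

Lemma near_in_chart U F G : affine_open U -> (forall x, U x -> F x = G x) ->
  forall x, U x -> \forall z \near (0 : 'rV[R]_(\dim {:E})), in_chart F x z = in_chart G x z.
Proof. by move=> oU FG x /oU; apply: filterS => z; exact: FG. Qed.

Lemma affine_diffE F x w : differentiable (in_chart F x) 0 ->
  affine_diff F x w = partial F w x.
Proof.
move=> dF; rewrite /partial deriveE // /affine_diff.
(* [linfun] is known to agree with its argument only for a linear map, so linearity is packed into a
   structure before [lfunE] is applied. *)
have lin : linear (fun w => 'd (in_chart F x) 0 (rVof (vbasis {:E}) w) : R^o).
  by move=> a u v; rewrite !linearP.
pose m := GRing.isLinear.Build _ _ _ _ _ lin.
pose l : {linear E -> R^o} :=
  HB.pack (fun w => 'd (in_chart F x) 0 (rVof (vbasis {:E}) w) : R^o) m.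
exact: (lfunE l).
Qed.

Lemma eq_partial U F G : affine_open U -> (forall x, U x -> F x = G x) ->
  forall w x, U x -> partial F w x = partial G w x.
Proof. by move=> oU FG w x Ux; apply: near_eq_derive; apply: near_in_chart FG x Ux. Qed.

Lemma partialD F G w x :
  differentiable (in_chart F x) 0 -> differentiable (in_chart G x) 0 ->
  partial (fun y => F y + G y) w x = partial F w x + partial G w x.
Proof. by move=> dF dG; apply: deriveD; apply: diff_derivable. Qed.

Lemma partialM F G w x :
  differentiable (in_chart F x) 0 -> differentiable (in_chart G x) 0 ->
  partial (fun y => F y * G y) w x = F x * partial G w x + G x * partial F w x.
Proof.
move=> dF dG; rewrite -{1}(in_chart0 F) -{1}(in_chart0 G).
by apply: deriveM; apply: diff_derivable.
Qed.

Lemma partialV F w x : F x != 0 -> differentiable (in_chart F x) 0 ->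
  partial (fun y => (F y)^-1) w x = - (F x) ^- 2 * partial F w x.
Proof.
rewrite -(in_chart0 F) => F0 dF.
by apply: deriveV => //; apply: diff_derivable.
Qed.

Lemma partial_sum n (F : 'I_n -> A -> R) w x :
  (forall i, differentiable (in_chart (F i) x) 0) ->
  partial (fun y => \sum_i F i y) w x = \sum_i partial (F i) w x.
Proof.
move=> dF; rewrite /partial.
have -> : in_chart (fun y => \sum_i F i y) x = \sum_i in_chart (F i) x.
  by apply/funext => z; rewrite fct_sumE.
by apply: derive_sum => i; apply: diff_derivable.
Qed.

Lemma partialZ c F w x : differentiable (in_chart F x) 0 ->
  partial (fun y => c * F y) w x = c * partial F w x.
Proof. by move=> dF; apply: deriveZ; apply: diff_derivable. Qed.

Lemma partial0 F x : partial F 0 x = 0.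
Proof. by rewrite /partial linear0 derive0. Qed.

(** Partial derivatives are local, so on an open set equality passes to them and the induction goes
    through. This is needed because the rules for sums, products and inverses give the derivatives
    only at points of [U]. *)
Lemma eq_Ck_on k U F G : affine_open U -> (forall x, U x -> F x = G x) ->
  Ck_on k U F -> Ck_on k U G.
Proof.
move=> oU; elim: k F G => [|k IH] F G FG /=.
  move=> cF x Ux; have FGx := near_in_chart oU FG Ux.
  exact: near_eq_continuous_at FGx (cF x Ux).
move=> [dF pF]; split=> [x Ux|w].
  exact: near_eq_differentiable (near_in_chart oU FG Ux) (dF x Ux).
by apply: IH (pF w) => x Ux; apply: eq_partial Ux.
Qed.

Lemma Ck_on_pred k U F : Ck_on k.+1 U F -> Ck_on k U F.
Proof.
elim: k F => [|k IH] F [dF pF]; first by move=> x Ux; apply: differentiable_continuous (dF x Ux).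
by split=> // w; apply: IH.
Qed.

Lemma Ck_onD k U F G : affine_open U -> Ck_on k U F -> Ck_on k U G ->
  Ck_on k U (fun x => F x + G x).
Proof.
move=> oU; elim: k F G => [|k IH] F G /=.
  by move=> cF cG x Ux; exact: continuousD (cF x Ux) (cG x Ux).
move=> [dF pF] [dG pG]; split=> [x Ux|w].
  exact: differentiableD (dF x Ux) (dG x Ux).
apply: (eq_Ck_on oU _ (IH _ _ (pF w) (pG w))) => x Ux.
by rewrite -partialD; [|exact: dF|exact: dG].
Qed.

(** The Leibniz rule involves the factors along with their partials, so [Ck_on_pred] first lowers
    the factors to order [k]. *)
Lemma Ck_onM k U F G : affine_open U -> Ck_on k U F -> Ck_on k U G ->
  Ck_on k U (fun x => F x * G x).
Proof.
move=> oU; elim: k F G => [|k IH] F G.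
  by move=> cF cG x Ux; exact: continuousM (cF x Ux) (cG x Ux).
move=> CF CG; have [dF pF] := CF; have [dG pG] := CG; split=> [x Ux|w].
  exact: differentiableM (dF x Ux) (dG x Ux).
have C := Ck_onD oU (IH _ _ (Ck_on_pred CF) (pG w)) (IH _ _ (Ck_on_pred CG) (pF w)).
apply: (eq_Ck_on oU _ C) => x Ux.
by rewrite -partialM; [|exact: dF|exact: dG].
Qed.

Lemma Ck_onZ k U c F : affine_open U -> Ck_on k U F ->
  Ck_on k U (fun x => c * F x).
Proof. by move=> oU; apply: Ck_onM => //; exact: Ck_on_cst. Qed.

Lemma affine_open_gt0 F : Ck_on 0 setT F -> affine_open [set x | 0 < F x].
Proof.
move=> cF x /= Fx; have cFx := cF x I.
by apply: cvgr_gt cFx _ _; rewrite in_chart0.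
Qed.

(** The partials of [F^-1] are [- F^-2] times those of [F], so the induction hypothesis for [F^-1]
    itself bounds the order of the right-hand side from below. *)
Lemma Ck_onV k U F : affine_open U -> (forall x, U x -> F x != 0) ->
  Ck_on k U F -> Ck_on k U (fun x => (F x)^-1).
Proof.
move=> oU F0; elim: k F F0 => [|k IH] F F0.
  move=> cF x Ux; apply: continuousV (cF x Ux).
  by rewrite in_chart0 F0.
move=> CF; have [dF pF] := CF; split=> [x Ux|w].
  by apply: differentiableV (dF x Ux) _; rewrite in_chart0 F0.
have CV := IH _ F0 (Ck_on_pred CF).
have C := Ck_onM oU (Ck_on_cst k U (-1)) (Ck_onM oU (Ck_onM oU CV CV) (pF w)).
apply: (eq_Ck_on oU _ C) => x Ux; rewrite partialV ?F0 //; last exact: dF.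
by rewrite mulrA mulN1r -expr2 exprVn.
Qed.

Lemma Ck_on_sum k U n (F : 'I_n -> A -> R) : affine_open U ->
  (forall i, Ck_on k U (F i)) -> Ck_on k U (fun x => \sum_i F i x).
Proof.
move=> oU; elim: n F => [|n IH] F CF.
  apply: (eq_Ck_on oU _ (Ck_on_cst k U 0)) => x _; by rewrite big_ord0.
apply: (eq_Ck_on oU _ (Ck_onD oU (CF ord0) (IH _ (fun i => CF (lift ord0 i))))) => x _.
by rewrite big_ord_recl.
Qed.

Lemma affine_dual_comp (E' : vectType R) (f : A -> E') (l : 'Hom(E, E')) (d : dual E') :
  (forall x v, f (translate x v) = f x + l v) ->
  forall x v, d (f (translate x v)) = d (f x) + (d \o l)%VF v.
Proof. by move=> fl x v; rewrite fl linearD /= lfunE. Qed.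

End AffineCalculusTheory.

(** * Composition with an affine map *)

Section AffineComposition.
Context (R : realType) (E E' : vectType R) (A : affineSpace E) (B : affineSpace E').
Context (h : A -> B) (l : 'Hom(E, E')).
Context (hl : forall x v, h (translate x v) = translate (h x) (l v)).
Implicit Types (F : B -> R).

Lemma in_chart_comp F x :
  in_chart (F \o h) x =
  in_chart F (h x) \o (rVof (vbasis {:E'}) \o l \o vecof (vbasis {:E})).
Proof.
by apply/funext => z; rewrite /in_chart /affine_chart /= hl (rVofK (vbasisP _)).
Qed.

Let lin : {linear 'rV[R]_(\dim {:E}) -> 'rV[R]_(\dim {:E'})} :=
  rVof (vbasis {:E'}) \o l \o vecof (vbasis {:E}).

Lemma differentiable_in_chart_comp F x : differentiable (in_chart F (h x)) 0 ->
  differentiable (in_chart (F \o h) x) 0.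
Proof.
move=> dF; rewrite in_chart_comp; apply: differentiable_comp.
  exact: (linear_differentiable (f := lin)) (@rV_linear_continuous _ _ _ lin).
by rewrite /= !linear0.
Qed.

(** An affine map sends lines to lines, so the two difference quotients are the same function of the
    increment and the limits agree. *)
Lemma partial_comp F w x : partial (F \o h) w x = partial F (l w) (h x).
Proof.
rewrite /partial in_chart_comp /derive.
apply: (congr1 (fun f : R -> R => lim (f c @[c --> 0^']))).
by apply/funext => c /=; rewrite !addr0 !linear0 !linearZ /= (rVofK (vbasisP _)).
Qed.

Lemma Ck_on_comp k (U : set A) (U' : set B) F :
  (forall x, U x -> U' (h x)) -> Ck_on k U' F -> Ck_on k U (F \o h).
Proof.
move=> UU'; elim: k F => [|k IH] F.
  move=> cF x /UU' Ux; rewrite in_chart_comp.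
  apply: (@continuous_comp _ _ _ lin (in_chart F (h x))).
    exact: rV_linear_continuous.
  by rewrite linear0; exact: cF.
move=> [dF pF]; split=> [x /UU' Ux|w].
  exact: differentiable_in_chart_comp (dF _ Ux).
have -> : partial (F \o h) w = partial F (l w) \o h.
  by apply/funext => x; rewrite partial_comp.
exact: IH (pF _).
Qed.

End AffineComposition.

(** * Bilinear expressions in affine maps *)

Section Bilinear.
Context (R : realType) (E E1 E2 : vectType R) (A : affineSpace E).
Context (b : 'Hom(E1, dual E2)) (f1 : A -> E1) (f2 : A -> E2).
Context (l1 : 'Hom(E, E1)) (l2 : 'Hom(E, E2)).
Context (fl1 : forall x v, f1 (translate x v) = f1 x + l1 v).
Context (fl2 : forall x v, f2 (translate x v) = f2 x + l2 v).

(** Expanding the first argument in a basis turns the bilinear form into a finite sum of products of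
    linear forms, to which the sum and product rules apply. *)
Let bE a c : b a c = \sum_i (linfun (coord (vbasis {:E1}) i) a * b (vbasis {:E1})`_i c).
Proof.
rewrite {1}[a](coord_vbasis (memvf _)) linear_sum sum_lfunE.
by apply: eq_bigr => i _; rewrite linearZ scale_lfunE lfunE.
Qed.

Let bfE : (fun x => b (f1 x) (f2 x)) =
  fun x => \sum_i (linfun (coord (vbasis {:E1}) i) (f1 x) * b (vbasis {:E1})`_i (f2 x)).
Proof. by apply/funext => x; rewrite bE. Qed.

Lemma Ck_on_bilinear k (U : set A) : affine_open U -> Ck_on k U (fun x => b (f1 x) (f2 x)).
Proof.
move=> oU; rewrite bfE; apply: Ck_on_sum => // i.
apply: Ck_onM => //.
  exact: Ck_on_affine (affine_dual_comp _ fl1).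
exact: Ck_on_affine (affine_dual_comp _ fl2).
Qed.

Lemma partial_bilinear w x :
  partial (fun x => b (f1 x) (f2 x)) w x = b (l1 w) (f2 x) + b (f1 x) (l2 w).
Proof.
have d1 i := in_chart_affine (F := fun y => linfun (coord (vbasis {:E1}) i) (f1 y) : R)
    (affine_dual_comp (linfun (coord (vbasis {:E1}) i)) fl1 x).
have d2 i := in_chart_affine (F := fun y => b (vbasis {:E1})`_i (f2 y) : R)
    (affine_dual_comp (b (vbasis {:E1})`_i) fl2 x).
rewrite bfE partial_sum => [|i]; last exact: differentiableM (d1 i).1 (d2 i).1.
rewrite [b (l1 w) _]bE [b (f1 x) (l2 w)]bE -big_split /=.
apply: eq_bigr => i _; rewrite partialM ?(d1 i).2 ?(d2 i).2; [|exact: (d1 i).1|exact: (d2 i).1].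
rewrite !comp_lfunE /= addrC.
by congr (_ + _); exact: mulrC.
Qed.

End Bilinear.

(** * The Hamiltonian in the frame [frame0] *)

Section Hamiltonian.
Context (R : realType) (S : newtonianSpacetime R) (m : R) (phi : st_N S -> R).
Local Notation V := (st_V S).
Local Notation N := (st_N S).
Local Notation tau := (@st_tau R S).
Local Notation g := (@st_g R S).
Local Notation iota := Defs.iota.
Local Notation u0 := (frame0 S).
Local Notation NP := (affine_NP S m).
Local Notation Y := (affine_prod NP (affine_self V)).
Local Notation X := (NPVplus S m : set Y).
Local Notation TY := ((V * dual V) * V)%type.

(* The representative of [q] in the frame [u0]. *)
Definition momentum (q : P S m) : dual V := (repr q).2 + m *: sigma (repr q).1 u0.

Lemma momentumK q : P_class m u0 (momentum q) = q.
Proof.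
by rewrite -[RHS]reprK /momentum; case: (repr q) => u p /=; apply/P_classP.
Qed.

Lemma P_classK p : momentum (P_class m u0 p) = p.
Proof.
have /P_classP -> := momentumK (P_class m u0 p).
have -> : sigma u0 u0 = 0 by apply/lfunP => v; rewrite sigma_cobound subrr lfunE.
by rewrite scaler0 addr0.
Qed.

Lemma momentum_translate (q : P S m) p : momentum (P_translate q p) = momentum q + p.
Proof. by rewrite -{1}(momentumK q) P_translateE P_classK. Qed.

(** Once [q] is represented in [u0], both arguments of [W_diff] are classes in that frame, and their
    difference is that of the real components. *)
Lemma hamiltonianE (y : N * P S m * V) :
  hamiltonian m phi y = momentum y.1.2 y.2 - lagrangian m phi u0 y.1.1 y.2.
Proof.
case: y => [[x q] v] /=; rewrite -{1}(momentumK q) pairingE.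
exact: W_diffE.
Qed.

Let pr_v : 'Hom(TY, V) := linfun snd.
Let pr_x : 'Hom(TY, V) := (linfun fst \o linfun fst)%VF.
Let pr_p : 'Hom(TY, dual V) := (linfun snd \o linfun fst)%VF.
Let duration (y : Y) : R := tau y.2.
Let kinetic (y : Y) : R := g (iota (val u0) y.2) (iota (val u0) y.2).
(** The function is a parameter because the partial derivatives of [phi] are pulled back in the same
    way as [phi]. *)
Let potential (f : N -> R) (y : Y) : R := f y.1.1.
Let momentum_v (y : Y) : R := momentum y.1.2 y.2.

(** This sum of products, with [-1 *] for the signs, has the shape of the rules for [Ck_on] and
    [partial]. The equality of functions holds even where [duration] vanishes, as [invfM] is
    unconditional. *)
Let neg_hamiltonianE : (fun y => - hamiltonian m phi y) = (fun y =>
  m / 2 * (kinetic y * (duration y)^-1) +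
  (-1 * (duration y * potential phi y) + -1 * momentum_v y)).
Proof.
apply/funext => y; rewrite hamiltonianE /lagrangian invfM.
rewrite /kinetic /duration /potential /momentum_v; ring.
Qed.

Let pr_vE d : pr_v d = d.2. Proof. by rewrite lfunE. Qed.
Let pr_xE d : pr_x d = d.1.1. Proof. by rewrite comp_lfunE !lfunE. Qed.
Let pr_pE d : pr_p d = d.1.2. Proof. by rewrite comp_lfunE !lfunE. Qed.

Let v_translate (y : Y) d : (translate y d).2 = y.2 + pr_v d.
Proof. by rewrite pr_vE. Qed.

Let iota_translate u (y : Y) d :
  iota u (translate y d).2 = iota u y.2 + (iota u \o pr_v)%VF d.
Proof. by rewrite v_translate linearD comp_lfunE. Qed.

Let p_translate (y : Y) d : momentum (translate y d).1.2 = momentum y.1.2 + pr_p d.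
Proof. by rewrite pr_pE -momentum_translate. Qed.

Let x_translate (y : Y) d : (translate y d).1.1 = translate y.1.1 (pr_x d).
Proof. by rewrite pr_xE. Qed.

Let affine_duration := @affine_dual_comp R _ Y V _ pr_v tau v_translate.

Lemma affine_open_NPVplus : affine_open X.
Proof. exact: affine_open_gt0 (Ck_on_affine 0 setT affine_duration). Qed.
Let oX := affine_open_NPVplus.

(** * Smoothness and first derivatives of the negative Hamiltonian *)

Context (phi_smooth : smooth_on setT phi).

Let duration_neq0 (y : Y) : X y -> duration y != 0.
Proof. exact: lt0r_neq0. Qed.

Let Ck_duration k : Ck_on k X duration := Ck_on_affine k X affine_duration.

Let Ck_kinetic k : Ck_on k X kinetic.
Proof. exact: (Ck_on_bilinear g (iota_translate _) (iota_translate _)). Qed.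

(** The identity of the dual space, read as a bilinear form, is the evaluation pairing; this makes
    the bilinear calculus available. *)
Let momentum_vE : momentum_v = fun y : Y => (\1%VF (momentum y.1.2) : dual V) y.2.
Proof. by apply/funext => y; rewrite id_lfunE. Qed.

Let Ck_momentum_v k : Ck_on k X momentum_v.
Proof. rewrite momentum_vE; exact: (Ck_on_bilinear \1%VF p_translate v_translate). Qed.

Let Ck_potential k f : Ck_on k setT f -> Ck_on k X (potential f).
Proof. exact: (Ck_on_comp (h := fun y : Y => y.1.1) x_translate (fun _ _ => I)). Qed.

Lemma smooth_on_hamiltonian :
  smooth_on X (fun y => - hamiltonian m phi y).
Proof.
move=> k; rewrite neg_hamiltonianE; apply: Ck_onD => //.
  apply: Ck_onZ => //; apply: Ck_onM => //.
  exact: Ck_onV.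
apply: Ck_onD => //; apply: Ck_onZ => //.
by apply: Ck_onM => //; apply: Ck_potential.
Qed.

(** The direction [d] has components [d.1.1] along space-time, [d.1.2] along the momenta and [d.2]
    along the fibre. *)
Lemma partial_hamiltonian (y : Y) (d : TY) : X y ->
  partial (fun y : Y => - hamiltonian m phi y) d y =
    m / 2 * (kinetic y * (- (duration y) ^- 2 * tau d.2)
             + (duration y)^-1 * (g (iota (val u0) d.2) (iota (val u0) y.2) *+ 2))
  - (duration y * partial phi d.1.1 y.1.1 + phi y.1.1 * tau d.2)
  - (d.1.2 y.2 + momentum y.1.2 d.2).
Proof.
move=> Xy; rewrite neg_hamiltonianE.
have dX F : Ck_on 1 X F -> differentiable (in_chart F y) 0 by case=> + _; exact.
have dT := dX _ (Ck_duration 1); have dK := dX _ (Ck_kinetic 1).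
have dM := dX _ (Ck_momentum_v 1); have dV := dX _ (Ck_onV oX duration_neq0 (Ck_duration 1)).
have dP := dX _ (Ck_potential (phi_smooth 1)).
have dTP := differentiableM dT dP; have dKV := differentiableM dK dV.
have pT : partial duration d y = tau d.2.
  by rewrite (in_chart_affine (affine_duration y)).2 comp_lfunE pr_vE.
have pK : partial kinetic d y = g (iota (val u0) d.2) (iota (val u0) y.2) *+ 2.
  rewrite (partial_bilinear g (iota_translate _) (iota_translate _)).
  (* The two Leibniz terms coincide by symmetry of [g]. *)
  by rewrite !comp_lfunE pr_vE [X in _ + X]st_g_sym.
have pM : partial momentum_v d y = d.1.2 y.2 + momentum y.1.2 d.2.
  rewrite momentum_vE (partial_bilinear \1%VF p_translate v_translate).
  by rewrite !id_lfunE pr_pE pr_vE.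
have pP : partial (potential phi) d y = partial phi d.1.1 y.1.1.
  by rewrite (partial_comp (h := fun y : Y => y.1.1) x_translate) pr_xE.
(* The products of charts are restated as charts of products, the form in which [partialD] and
   [partialZ] take them. *)
have {}dKV : differentiable (in_chart (fun y : Y => kinetic y * (duration y)^-1) y) 0 by [].
have {}dTP : differentiable (in_chart (fun y : Y => duration y * potential phi y) y) 0 by [].
have dKV' := differentiableZ (m / 2) dKV.
have dTP' := differentiableZ (-1) dTP; have dM' := differentiableZ (-1) dM.
rewrite (partialD _ dKV' (differentiableD dTP' dM')) (partialD _ dTP' dM').
rewrite !partialZ // !partialM // partialV ?duration_neq0 // pT pK pM pP.
rewrite /potential /=; ring.
Qed.

Lemma affine_diff_hamiltonian (y : Y) (d : TY) : X y ->
  affine_diff (fun y : Y => - hamiltonian m phi y) y d =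
    m / 2 * (kinetic y * (- (duration y) ^- 2 * tau d.2)
             + (duration y)^-1 * (g (iota (val u0) d.2) (iota (val u0) y.2) *+ 2))
  - (duration y * affine_diff phi y.1.1 d.1.1 + phi y.1.1 * tau d.2)
  - (d.1.2 y.2 + momentum y.1.2 d.2).
Proof.
move=> Xy; rewrite affine_diffE; last exact: (smooth_on_hamiltonian 1).1.
by rewrite partial_hamiltonian // affine_diffE //; exact: (phi_smooth 1).1.
Qed.

(** * The set generated by the negative Hamiltonian *)

Lemma comp_fstE (c : dual (V * dual V)%type) (d : TY) : (c \o linfun fst)%VF d = c d.1.
Proof. by rewrite comp_lfunE [linfun _ _]lfunE. Qed.

Lemma NP_covectorE (a : dual V) (v : V) d : NP_covector a v d = a d.1 + d.2 v :> R.
Proof. by rewrite /NP_covector lfunE. Qed.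

Lemma legendre_momentumE (u v w : V) (x : N) :
  ((m / tau v) *: iota_dual u (g (iota u v))
          - (m / (2 * tau v ^+ 2) * g (iota u v) (iota u v)) *: tau
          - phi x *: tau) w
  = m / tau v * g (iota u v) (iota u w)
    - m / (2 * tau v ^+ 2) * g (iota u v) (iota u v) * tau w - phi x * tau w :> R.
Proof. by rewrite !(add_lfunE, opp_lfunE) !scale_lfunE [iota_dual _ _ _]comp_lfunE. Qed.

Lemma generated_hamiltonian :
  beta S m @` dynamics m phi = generated NP X (fun y => - hamiltonian m phi y).
Proof.
apply/seteqP; split.
  move=> _ [_ [[[x p] [xd pd]] [v [vX -> -> ->]] <-] <-]; exists v; split; first exact: vX.
  have tv : tau v != 0 :> R := lt0r_neq0 vX.
  (* With the Legendre momentum inserted, all terms in [d.2] cancel; what remains is the covector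
     with components [- tau v] times the differential of [phi], and [- v]. *)
  apply/lfunP => d; rewrite [LHS]affine_diff_hamiltonian //.
  rewrite [RHS]comp_fstE [RHS]NP_covectorE /fst /snd P_classK legendre_momentumE.
  rewrite linearN scale_lfunE [g (iota _ d.2) _]st_g_sym /kinetic /duration /=.
  rewrite /GRing.scale /=.
  by field.
move=> [[x q] c] /= [v [vX /lfunP bE]].
have tv : tau v != 0 :> R := lt0r_neq0 vX.
(* The left side does not see [d.2]. Hence [d.2 = 0] determines [c], while [d.1 = 0] makes the fibre
   derivative vanish, which is the Legendre condition. *)
have {}bE (d : TY) : c d.1 = _ :=
  etrans (esym (etrans (bE d) (comp_fstE c d))) (affine_diff_hamiltonian d vX).
exists ((x, q), (v, - (tau v : R) *: affine_diff phi x)); last first.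
  congr (_, _); apply/lfunP => d; rewrite NP_covectorE linearN scale_lfunE.
  rewrite (bE (d, 0)) /duration /= !linear0 lfunE /GRing.scale /=.
  ring.
exists ((x, momentum q), (v, - (tau v : R) *: affine_diff phi x)); last by rewrite /= momentumK.
exists v; split => //; apply/lfunP => w; rewrite legendre_momentumE.
(* Along the fibre direction [w] the equation expresses [momentum q w] through [v] and [x]. *)
have := bE ((0, 0), w); rewrite /fst /snd !linear0 [(0 : dual V) v]lfunE add0r.
move=> /esym/subr0_eq <-; rewrite [g (iota _ w) _]st_g_sym /kinetic /duration /=.
by field.
Qed.

(** * The Morse condition *)

Lemma partial_base_hamiltonian (a : V * dual V) (y : Y) : X y ->
  partial (fun y : Y => - hamiltonian m phi y) (a, 0) y =
    -1 * (duration y * potential (partial phi a.1) y) + -1 * a.2 y.2.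
Proof.
move=> Xy; rewrite partial_hamiltonian // /potential /= !linear0 lfunE /=; ring.
Qed.

Lemma partial_fibre_base_hamiltonian (y : Y) (a : V * dual V) (w : V) : X y ->
  partial (partial (fun y : Y => - hamiltonian m phi y) (a, 0)) (0, w) y =
    - (tau w * partial phi a.1 y.1.1 + a.2 w).
Proof.
move=> Xy; rewrite (eq_partial oX (@partial_base_hamiltonian a) (0, w) Xy).
have dX F : Ck_on 1 X F -> differentiable (in_chart F y) 0 by case=> + _; exact.
have dT := dX _ (Ck_duration 1).
have dphi : Ck_on 1 setT (partial phi a.1) := (phi_smooth 2).2 a.1.
have dP := dX _ (Ck_potential dphi).
have affine_a := affine_dual_comp a.2 v_translate.
have da := dX (fun y => a.2 y.2) (Ck_on_affine 1 X affine_a).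
have dTP : differentiable (in_chart (fun y => duration y * potential (partial phi a.1) y) y) 0.
  exact: differentiableM dT dP.
rewrite (partialD _ (differentiableZ (-1) dTP) (differentiableZ (-1) da)).
rewrite !partialZ // partialM //.
(* The direction [(0, w)] fixes the space-time point, so no second derivative of [phi] appears. *)
rewrite (partial_comp (h := fun y : Y => y.1.1) x_translate) pr_xE partial0.
rewrite (in_chart_affine (affine_duration y)).2 (in_chart_affine (affine_a y)).2.
rewrite !comp_lfunE pr_vE /potential /=; ring.
Qed.

(** The mixed block already has independent rows. A row relation [c] gives a vector [w] whose mixed
    derivatives with all base directions vanish; the momentum directions separate vectors of [V], so
    [w = 0], and [c = 0] since [f] is free. *)
Lemma row_free_morse_hamiltonian (n k : nat) (e : n.-tuple (V * dual V)%type)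
    (f : k.-tuple V) (y : Y) :
  basis_of fullv e -> basis_of fullv f -> X y ->
  row_free (morse_matrix (B := NP) e f (fun y => - hamiltonian m phi y) y).
Proof.
move=> be bf Xy; apply: inj_row_free => c.
rewrite /morse_matrix mul_mx_row => /(congr1 lsubmx).
rewrite row_mxKl linear0 => cE.
pose w := \sum_i c 0 i *: f`_i.
have lw (l : dual V) : l w = \sum_i c 0 i * l (tnth f i) :> R.
  by rewrite linear_sum; apply: eq_bigr => i _; rewrite linearZ (tnth_nth 0).
(* Up to sign, [L] is the mixed second derivative in the fibre direction [w], as a covector on the
   base. *)
pose L := NP_covector (tau w *: affine_diff phi y.1.1) w.
have Le j : L e`_j = 0.
  (* Beyond the length of [e] the entry is the default vector 0, on which [L] vanishes. *)
  have [jn|nj] := ltnP j n; last by rewrite nth_default ?size_tuple // linear0.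
  have := congr1 (fun M : 'rV_n => M 0 (Ordinal jn)) cE; rewrite !mxE => cj.
  apply/eqP; rewrite -oppr_eq0 -[X in _ == X]cj; apply/eqP.
  under [RHS]eq_bigr do rewrite !mxE partial_fibre_base_hamiltonian // mulrN.
  rewrite sumrN; congr (- _); rewrite /L NP_covectorE scale_lfunE.
  rewrite affine_diffE; last exact: (phi_smooth 1).1.
  rewrite (tnth_nth 0) /GRing.scale /= !lw mulr_suml -big_split /=.
  by apply: eq_bigr => i _; rewrite mulrDr mulrA.
have L0 d : L d = 0.
  rewrite (coord_basis be (memvf d)) linear_sum big1 // => i _.
  by rewrite linearZ /= [L _]Le scaler0.
have w0 : w = 0.
  rewrite [w](coord_vbasis (memvf _)) big1 // => i _.
  (* Evaluating [L] on a pure momentum direction, a coordinate form, gives the corresponding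
     coordinate of [w]. *)
  have := L0 (0, linfun (coord (vbasis {:V}) i)).
  by rewrite /L NP_covectorE linear0 add0r /= lfunE /= => ->; rewrite scale0r.
have /freeP/(_ _ w0) c0 := basis_free bf.
by apply/rowP => i; rewrite c0 mxE.
Qed.

End Hamiltonian.

Theorem mainTheorem3 (R : realType) (S : newtonianSpacetime R) (m : R)
    (phi : st_N S -> R) (m_gt0 : 0 < m) (phi_smooth : smooth_on setT phi) :
  morse_family (affine_NP S m) (NPVplus S m)
    (fun y => - hamiltonian m phi y) /\
  beta S m @` dynamics m phi =
    generated (affine_NP S m) (NPVplus S m) (fun y => - hamiltonian m phi y).
Proof.
split; last exact: generated_hamiltonian.
split.
- exact: affine_open_NPVplus.
(* Every fibre contains the vector [frame0], on which [tau] takes the value 1. *)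
- by move=> q; exists (val (frame0 S));
  rewrite /NPVplus /Vplus /= (eqP (valP (frame0 S))) ltr01.
- exact: smooth_on_hamiltonian.
- by move=> n k e f be bf y Xy _; exact: row_free_morse_hamiltonian.
Qed.
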